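(* Let $\bar L:G\times\mathfrak g\to\mathbb R$ be a Lagrangian. The Lagrangian dynamics determined by the Lagrangian submanifold $$S=\left\{\left(g,\frac{\delta\bar L}{\delta\xi},\xi,T_e^*R_g\frac{\delta\bar L}{\delta g}\right)\in{}^1TT^*G:(g,\xi)\in G\times\mathfrak g\right\}$$ is generated by the Morse family $$E^{\bar L\to\bar H}(g,\xi,\mu)=\bar L(g,\xi)+\Delta=\bar L(g,\xi)-\langle\mu,\xi\rangle$$ defined on the trivialized Pontryagin bundle ${}^1PG=G\times(\mathfrak g\times\mathfrak g^* )$ over $G\times\mathfrak g^*$ (projection $(g,\xi,\mu)\mapsto(g,\mu)$). Here $\Delta=-\langle\mu,\xi\rangle$ satisfies, as a function on ${}^1TT^*G$, $d\Delta=\theta_1-\theta_2$, whose value on $X_{(\xi_2,\nu_2,\xi_3,\nu_3)}$ is $-\langle\mu,\xi_3\rangle-\langle\nu_2,\xi\rangle$. ''Generated'' means: $E^{\bar L\to\bar H}$ is a Morse family, and if $S_{T^*(G\times\mathfrak g^* )}$ is the Lagrangian submanifold of $T^*(G\times\mathfrak g^* )$ it generates, then $$({}^1\Omega^\flat)^{-1}\big(tr^1(S_{T^*(G\times\mathfrak g^* )})\big)=S.$$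
   Context: $G$ is a Lie group with identity $e$, and $\mathfrak g\simeq T_eG$ is its Lie algebra, assumed reflexive ($\mathfrak g^{**}=\mathfrak g$), with dual $\mathfrak g^*$. $R_g$ is right multiplication. The bracket on $\mathfrak g$ is that of right invariant vector fields: $X^G_{[\xi,\eta]}=[X^G_\xi,X^G_\eta]_{JL}$, where $X^G_\xi(g)=T_eR_g\xi$. $\langle ad^*_\xi\mu,\eta\rangle=\langle\mu,[\xi,\eta]\rangle$. $T_e^*R_g:T_g^*G\to\mathfrak g^*$ is the dual of $T_eR_g$. $\delta\bar L/\delta g$, $\delta\bar L/\delta\xi$ are partial derivatives. ${}^1TT^*G=(G\times\mathfrak g^* )\times(\mathfrak g\times\mathfrak g^* )$ with points $(g,\mu,\xi,\nu)$, at which every tangent vector is uniquely $$X_{(\xi_2,\nu_2,\xi_3,\nu_3)}=(T_eR_g\xi_2,\nu_2+ad^*_{\xi_2}\mu,\xi_3+[\xi,\xi_2],\nu_3+ad^*_{\xi_2}\nu-ad^*_\xi\nu_2),$$ with $\xi_2,\xi_3\in\mathfrak g$ and $\nu_2,\nu_3\in\mathfrak g^*$. The one-forms are $$\langle\theta_1,X_{(\xi_2,\nu_2,\xi_3,\nu_3)}\rangle=\langle\nu,\xi_2\rangle-\langle\nu_2,\xi\rangle+\langle\mu,[\xi,\xi_2]\rangle,$$ $$\langle\theta_2,X_{(\xi_2,\nu_2,\xi_3,\nu_3)}\rangle=\langle\mu,\xi_3\rangle+\langle\nu,\xi_2\rangle+\langle\mu,[\xi,\xi_2]\rangle.$$ The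 symplectic form on ${}^1TT^*G$ is $d\theta_1=d\theta_2$. ${}^1T^*T^*G=(G\times\mathfrak g^* )\times(\mathfrak g^*\times\mathfrak g)$. The trivialization of $T^*(G\times\mathfrak g^* )$ is $$tr^1:T^*(G\times\mathfrak g^* )\to{}^1T^*T^*G,\quad(\alpha_g,\alpha_\mu)\in T^*_{(g,\mu)}(G\times\mathfrak g^* )\mapsto(g,\mu,T_e^*R_g\alpha_g-ad^*_{\alpha_\mu}\mu,\alpha_\mu),$$ where $\alpha_\mu\in\mathfrak g^{**}=\mathfrak g$, and $${}^1\Omega^\flat:{}^1TT^*G\to{}^1T^*T^*G,\quad(g,\mu,\xi,\nu)\mapsto(g,\mu,\nu+ad^*_\xi\mu,-\xi).$$ Morse families: for a fibre bundle $\pi:\mathcal P\to\mathcal M$, let $V\mathcal P=\ker T\pi$ and let $V^0\mathcal P\subset T^*\mathcal P$ be the covectors annihilating $V\mathcal P$. A function $E:\mathcal P\to\mathbb R$ is a Morse family if $T_z\,\mathrm{im}(dE)+T_zV^0\mathcal P=T_zT^*\mathcal P$ for all $z\in\mathrm{im}(dE)\cap V^0\mathcal P$. It generates the (immersed) Lagrangian submanifold $\{\lambda\in T^*_x\mathcal M:\ x\in\mathcal M,\ \exists\,p\in\pi^{-1}(x)\text{ with }(T_p\pi)^*\lambda=dE(p)\}$ of $T^*\mathcal M$. *)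

(* Defs.v *)
From HB Require Import structures.
From mathcomp Require Import all_boot all_order all_algebra.
From mathcomp Require Import boolp classical_sets functions reals topology.
From mathcomp Require Import normedtype landau derive.

Set Implicit Arguments.
Unset Strict Implicit.
Unset Printing Implicit Defensive.

Import Order.TTheory GRing.Theory Num.Theory.
Import numFieldNormedType.Exports.

Local Open Scope classical_set_scope.
Local Open Scope ring_scope.

Section Hom.
Context {R : realType}.

Definition contlin {E F : normedModType R} : {pred (E -> F)} :=
  [pred f : E -> F | `[< linear f /\ continuous f >]].

Record hom (E F : normedModType R) : Type :=
  Hom { hom_fun :> E -> F ; hom_contlin : hom_fun \in contlin }.

HB.instance Definition _ (E F : normedModType R) := [isSub for @hom_fun E F].
HB.instance Definition _ (E F : normedModType R) :=
  [Choice of hom E F by <:].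

Section Theory.
Variables E F : normedModType R.
Implicit Types f g : hom E F.

Lemma hom_linear f : linear f.
Proof. by have /asboolP[] := hom_contlin f. Qed.

Lemma hom_continuous f : continuous f.
Proof. by have /asboolP[] := hom_contlin f. Qed.

HB.instance Definition _ f :=
  GRing.isLinear.Build R E F *:%R (hom_fun f) (hom_linear f).

Fact contlin_submod_closed : submod_closed (@contlin E F).
Proof.
split=> [|a f g].
  apply/asboolP; split; first by move=> k x y; rewrite /= scaler0 addr0.
  by move=> x; exact: cvg_cst.
move=> /asboolP[lf cf] /asboolP[lg cg]; apply/asboolP; split.
  move=> k x y.
  have E1 z : (a *: f + g) z = a *: f z + g z by [].
  by rewrite !E1 lf lg !scalerDr !scalerA [k * a]mulrC addrACA.
move=> x; apply: cvgD; last exact: cg.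
by apply: cvgZr; exact: cf.
Qed.

HB.instance Definition _ :=
  GRing.isSubmodClosed.Build R (E -> F) (@contlin E F) contlin_submod_closed.
HB.instance Definition _ := [SubChoice_isSubLmodule of hom E F by <:].

Definition opnorm f : R := sup [set `|f x| | x in [set x : E | `|x| <= 1]].

Lemma hom_bounded f : exists2 k : R, 0 <= k & forall x, `|f x| <= k * `|x|.
Proof.
have /linear_boundedP : bounded_near f (nbhs (0 : E)).
  by apply/linear_bounded_continuous; exact: hom_continuous.
by move=> /pinfty_ex_gt0[k k0 kP]; exists k => //; exact: ltW.
Qed.

Let S f := [set `|f x| | x in [set x : E | `|x| <= 1]].

Let S0 f : S f !=set0.
Proof. by exists `|f 0|; exists 0 => //=; rewrite normr0. Qed.

Let Sub f : has_ubound (S f).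
Proof.
have [k k0 kP] := hom_bounded f; exists k => _ [x /= x1 <-].
by rewrite (le_trans (kP x))// ler_piMr.
Qed.

Lemma opnormP f x : `|f x| <= opnorm f * `|x|.
Proof.
have [->|x0] := eqVneq x 0; first by rewrite linear0 !normr0 mulr0.
have nx : 0 < `|x| by rewrite normr_gt0.
rewrite -ler_pdivrMr//; apply: (ub_le_sup (Sub f)).
exists (`|x|^-1 *: x) => /=.
  by rewrite normrZ normfV normr_id mulVf// gt_eqF.
by rewrite linearZ /= normrZ normfV normr_id mulrC.
Qed.

Lemma opnorm_le f k : 0 <= k -> (forall x, `|f x| <= k * `|x|) -> opnorm f <= k.
Proof.
move=> k0 fk; apply: (ge_sup (S0 f)) => _ [x /= x1 <-].
by rewrite (le_trans (fk x))// ler_piMr.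
Qed.

Lemma opnorm_ge0 f : 0 <= opnorm f.
Proof.
apply: le_trans (normr_ge0 (f 0)) _; apply: (ub_le_sup (Sub f)).
by exists 0 => //=; rewrite normr0.
Qed.

Fact opnormD f g : opnorm (f + g) <= opnorm f + opnorm g.
Proof.
apply: opnorm_le => [|x]; first by rewrite addr_ge0 ?opnorm_ge0.
by rewrite mulrDl (le_trans (ler_normD _ _))// lerD ?opnormP.
Qed.

Let opnormZ_le k f : opnorm (k *: f) <= `|k| * opnorm f.
Proof.
apply: opnorm_le => [|x]; first by rewrite mulr_ge0 ?opnorm_ge0.
have -> : (k *: f) x = k *: f x by [].
by rewrite normrZ -mulrA ler_wpM2l ?opnormP.
Qed.

Fact opnormZ k f : opnorm (k *: f) = `|k| * opnorm f.
Proof.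
have [->|k0] := eqVneq k 0.
  rewrite normr0 mul0r scale0r; apply/eqP; rewrite eq_le opnorm_ge0 andbT.
  by apply: opnorm_le => // x; rewrite mul0r normr0.
apply/eqP; rewrite eq_le opnormZ_le /=.
rewrite -ler_pdivlMl ?normr_gt0// -normfV.
by rewrite -[X in opnorm X <= _](scalerK k0) opnormZ_le.
Qed.

Fact opnorm0_eq0 f : opnorm f = 0 -> f = 0.
Proof.
move=> f0; apply/val_inj/funext => x /=.
by apply/eqP; rewrite -normr_le0 (le_trans (opnormP f x))// f0 mul0r.
Qed.

HB.instance Definition _ :=
  Lmodule_isNormed.Build R (hom E F) opnormD opnormZ opnorm0_eq0.

End Theory.

(* [insubd 0 f] is [f] as an element of [hom E F] when [f] is linear and
   continuous, and 0 otherwise. *)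
Definition to_hom {E F : normedModType R} (f : E -> F) : hom E F := insubd 0 f.

Fact hom_comp_subproof (E F G : normedModType R) (g : hom F G) (f : hom E F) :
  (g \o f : E -> G) \in contlin.
Proof.
apply/asboolP; split=> [k x y|x]; first by rewrite /= !linearP.
by apply: continuous_comp; exact: hom_continuous.
Qed.

Definition hom_comp {E F G : normedModType R} (g : hom F G) (f : hom E F) :
  hom E G := Hom (hom_comp_subproof g f).

Definition dual (E : normedModType R) := hom E R^o.

End Hom.

(* The canonical map from [E] to its bidual is an isomorphism. *)
Definition reflexive_space {R : realType} (E : normedModType R) :=
  forall a : dual (dual E), exists! x : E, forall phi : dual E, a phi = phi x.

Section Calculus.
Context {R : realType} {E : normedModType R}.

(* Fréchet derivative as an element of [hom E F]; meaningful only where [f] is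
   differentiable. *)
Definition fderiv {F : normedModType R} (f : E -> F) (x : E) : hom E F :=
  to_hom ('d f x : E -> F).

(* Intended for open [U] only. *)
Fixpoint Ck (n : nat) {F : normedModType R} (U : set E) (f : E -> F) : Prop :=
  match n with
  | 0 => forall x, U x -> {for x, continuous f}
  | n'.+1 => (forall x, U x -> differentiable f x) /\ Ck n' U (fderiv f)
  end.

Definition Cinfty {F : normedModType R} (U : set E) (f : E -> F) : Prop :=
  forall n, Ck n U f.

End Calculus.

(* Outside [cdom], resp. the image of [cdom], the values of [coord], resp.
   [cinv], are irrelevant; the axioms are in [manifold]. *)
Record chart (M E : Type) : Type :=
  Chart { cdom : set M ; coord : M -> E ; cinv : E -> M }.

(* A manifold modelled on [E] is a type [M] with an atlas [c : M -> chart M E],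
   where [c x] is a chart around [x].  The topology of [M] is the one induced by
   the atlas.  The tangent space at [x] is identified with [E] through the chart
   [c x], and the tangent and cotangent bundles have carriers [M * E] and
   [M * dual E].  For a Lie group this induced topology is automatically
   Hausdorff. *)
Section Manifolds.
Context {R : realType}.

Definition manifold {M : Type} {E : normedModType R} (c : M -> chart M E) :=
  [/\ forall x, cdom (c x) x,
      forall x y, cdom (c x) y -> cinv (c x) (coord (c x) y) = y,
      forall x y, open (coord (c x) @` (cdom (c x) `&` cdom (c y))) &
      forall x y, Cinfty (coord (c x) @` (cdom (c x) `&` cdom (c y)))
                         (coord (c y) \o cinv (c x)) ].

Definition model_charts (E : normedModType R) : E -> chart E E :=
  fun=> Chart setT id id.

Definition prod_charts {M N : Type} {E F : normedModType R}
    (c : M -> chart M E) (d : N -> chart N F) : M * N -> chart (M * N) (E * F) :=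
  fun p => Chart (cdom (c p.1) `*` cdom (d p.2))
                 (fun q => (coord (c p.1) q.1, coord (d p.2) q.2))
                 (fun u => (cinv (c p.1) u.1, cinv (d p.2) u.2)).

Section Maps.
Context {M N : Type} {E F : normedModType R}.
Variables (c : M -> chart M E) (d : N -> chart N F).

Definition smooth_map (f : M -> N) := forall x, exists U : set E,
  [/\ open U, U (coord (c x) x), U `<=` coord (c x) @` cdom (c x),
      forall u, U u -> cdom (d (f x)) (f (cinv (c x) u)) &
      Cinfty U (coord (d (f x)) \o f \o cinv (c x))].

(* T_x f : T_x M -> T_(f x) N *)
Definition tangent_map (f : M -> N) (x : M) : hom E F :=
  fderiv (coord (d (f x)) \o f \o cinv (c x)) (coord (c x) x).

End Maps.

Section Functions.
Context {M : Type} {E : normedModType R}.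
Variable c : M -> chart M E.

Definition smooth_fun (f : M -> R^o) := smooth_map c (@model_charts R^o) f.

Definition dfun (f : M -> R^o) (x : M) : dual E :=
  tangent_map c (@model_charts R^o) f x.

(* Derivative at [y] of the change of coordinates from [c y] to [c x]. *)
Definition trans (x y : M) : hom E E :=
  fderiv (coord (c x) \o cinv (c y)) (coord (c y) y).

(* Derivative at [y] of the change of coordinates from [c x] to [c y]. *)
Definition trans_inv (x y : M) : hom E E :=
  fderiv (coord (c y) \o cinv (c x)) (coord (c x) y).

Definition cotangent_charts :
    M * dual E -> chart (M * dual E) (E * dual E) :=
  fun z => Chart [set w | cdom (c z.1) w.1]
    (fun w => (coord (c z.1) w.1, hom_comp w.2 (trans_inv z.1 w.1)))
    (fun u => let y := cinv (c z.1) u.1 in (y, hom_comp u.2 (trans z.1 y))).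

(* T_z S for a submanifold [S] of [M]: velocities at 0 of the smooth curves of
   [M] that stay in [S] and pass through [z] at time 0. *)
Definition tangent_to (S : set M) (z : M) : set E :=
  [set w | exists gamma : R -> M, exists2 e : R, 0 < e &
    [/\ gamma 0 = z,
        forall t, `|t| < e -> S (gamma t) /\ cdom (c z) (gamma t),
        Cinfty [set t : R^o | `|t| < e] (coord (c z) \o gamma) &
        w = derive1 (coord (c z) \o gamma : R^o -> E) 0 ] ].

(* A vector field [X] assigns to [x] an element of T_x M, read in the chart
   [c x]; [field_rep X x] is its local representative in the fixed chart [c x]. *)
Definition field_rep (X : M -> E) (x : M) : E -> E :=
  fun u => let y := cinv (c x) u in trans x y (X y).

(* Sign convention: [X, Y] = DY.X - DX.Y in a chart. *)
Definition jacobi_lie (X Y : M -> E) (x : M) : E :=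
  let u := coord (c x) x in
  fderiv (field_rep Y x) u (field_rep X x u)
  - fderiv (field_rep X x) u (field_rep Y x u).

End Functions.

Section Morse.
Context {P M : Type} {E F : normedModType R}.
Variables (cP : P -> chart P E) (cM : M -> chart M F) (pi : P -> M).

Definition vertical (p : P) : set E := [set v | tangent_map cP cM pi p v = 0].

Definition vertical_annihilator : set (P * dual E) :=
  [set z : P * dual E | forall v, vertical z.1 v -> z.2 v = 0].

Definition im_d (f : P -> R^o) : set (P * dual E) :=
  [set z : P * dual E | z.2 = dfun cP f z.1].

Definition morse_family (f : P -> R^o) : Prop :=
  smooth_fun cP f /\
  forall z, (im_d f `&` vertical_annihilator) z ->
    [set v + w | v in tangent_to (cotangent_charts cP) (im_d f) z
               & w in tangent_to (cotangent_charts cP) vertical_annihilator z]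
    = setT.

Definition generated (f : P -> R^o) : set (M * dual F) :=
  [set l : M * dual F | exists2 p, pi p = l.1 &
           hom_comp l.2 (tangent_map cP cM pi p) = dfun cP f p].

End Morse.
End Manifolds.

Definition lie_group {R : realType} {G : groupType} {E : normedModType R}
    (c : G -> chart G E) : Prop :=
  [/\ manifold c,
      smooth_map (prod_charts c c) c (fun p => p.1 * p.2)%g &
      smooth_map c c (fun g => g^-1)%g].

(* The Lie algebra of [G] is [E], as the tangent space at the identity. *)
Section LieGroups.
Context {R : realType} {G : groupType} {E : normedModType R}.
Variable c : G -> chart G E.

(* T_e R_g *)
Definition TR (g : G) : hom E E := tangent_map c c (fun h => h * g)%g 1%g.

Definition TRs (g : G) (alpha : dual E) : dual E := hom_comp alpha (TR g).

Definition right_inv_field (xi : E) : G -> E := fun g => TR g xi.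

(* X_[xi,eta] = [X_xi, X_eta], read at the identity. *)
Definition bracket (xi eta : E) : E :=
  jacobi_lie c (right_inv_field xi) (right_inv_field eta) 1%g.

Definition ad_star (xi : E) (mu : dual E) : dual E :=
  to_hom (fun eta => mu (bracket xi eta)).

Definition GD_charts := prod_charts c (@model_charts R (dual E)).

Definition PG_charts :=
  prod_charts c (prod_charts (@model_charts R E) (@model_charts R (dual E))).

Definition TTG : Type := ((G * dual E) * (E * dual E))%type.
Definition TsTG : Type := ((G * dual E) * (dual E * E))%type.

Definition TTG_charts :=
  prod_charts GD_charts
    (prod_charts (@model_charts R E) (@model_charts R (dual E))).

(* The tangent vector X_(xi2,nu2,xi3,nu3) at [z] = (g, mu, xi, nu); the factors
   other than [G] are vector spaces, equal to their tangent spaces. *)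
Definition TTvec (z : TTG) (a : (E * dual E) * (E * dual E)) :
    (E * dual E) * (E * dual E) :=
  let: ((g, mu), (xi, nu)) := z in
  let: ((xi2, nu2), (xi3, nu3)) := a in
  ((TR g xi2, nu2 + ad_star xi2 mu),
   (xi3 + bracket xi xi2, nu3 + ad_star xi2 nu - ad_star xi nu2)).

(* The tuple (xi2, nu2, xi3, nu3) such that [v] is the value of [TTvec z] on it;
   it exists and is unique because T_e R_g is an isomorphism. *)
Definition TTparam (z : TTG) (v : (E * dual E) * (E * dual E)) :
    (E * dual E) * (E * dual E) :=
  xget 0 [set a | TTvec z a = v].

Definition theta1 (z : TTG) (v : (E * dual E) * (E * dual E)) : R :=
  let: ((g, mu), (xi, nu)) := z in
  let: ((xi2, nu2), (xi3, nu3)) := TTparam z v in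
  nu xi2 - nu2 xi + mu (bracket xi xi2).

Definition theta2 (z : TTG) (v : (E * dual E) * (E * dual E)) : R :=
  let: ((g, mu), (xi, nu)) := z in
  let: ((xi2, nu2), (xi3, nu3)) := TTparam z v in
  mu xi3 + nu xi2 + mu (bracket xi xi2).

(* A covector of G x g^* at (g, mu) is an element of the dual of g x g^*; these
   are its components alpha_g and alpha_mu, the latter read in g^** = g. *)
Definition covector_g (l : dual (E * dual E)%type) : dual E :=
  to_hom (fun v => l (v, 0)).

Definition covector_mu (l : dual (E * dual E)%type) : E :=
  xget 0 [set x | forall phi : dual E, l (0, phi) = phi x].

Definition tr1 (z : (G * dual E) * dual (E * dual E)%type) : TsTG :=
  let: ((g, mu), l) := z in
  ((g, mu),
   (TRs g (covector_g l) - ad_star (covector_mu l) mu, covector_mu l)).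

Definition Omega_flat (z : TTG) : TsTG :=
  let: ((g, mu), (xi, nu)) := z in ((g, mu), (nu + ad_star xi mu, - xi)).

Section Lagrangian.
Variable L : G * E -> R^o.

Definition dL_dg (g : G) (xi : E) : dual E := dfun c (fun h => L (h, xi)) g.

Definition dL_dxi (g : G) (xi : E) : dual E :=
  dfun (@model_charts R E) (fun eta => L (g, eta)) xi.

Definition lagrangian_submanifold : set TTG :=
  [set z | exists g xi, z = ((g, dL_dxi g xi), (xi, TRs g (dL_dg g xi)))].

Definition morse_LH (p : G * (E * dual E)) : R^o :=
  let: (g, (xi, mu)) := p in L (g, xi) - mu xi.

End Lagrangian.

Definition PG_proj (p : G * (E * dual E)) : G * dual E := (p.1, p.2.2).

Definition Delta (z : TTG) : R^o :=
  let: ((g, mu), (xi, nu)) := z in - mu xi.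

End LieGroups.

(* Main.v *)
Require Import Defs.
From HB Require Import structures.
From mathcomp Require Import all_boot all_order all_algebra.
From mathcomp Require Import boolp classical_sets functions reals topology.
From mathcomp Require Import prodnormedzmodule normedtype landau derive.

Import Order.TTheory GRing.Theory Num.Theory.
Import numFieldNormedType.Exports.

Local Open Scope classical_set_scope.
Local Open Scope ring_scope.

(** Write a tangent vector of the Pontryagin bundle at [(g, (xi, mu))] as
    [(v, (w, k))], with [v] in the tangent space at [g], [w] in the Lie algebra
    and [k] in its dual.  The function [L(g, xi) - mu xi] has differential
      [(v, (w, k)) |-> dL/dg v + (dL/dxi - mu) w - k xi]
    ([dfun_morse], [dmorseE]), and the vertical vectors are the [(0, (w, 0))].

    Generated submanifold ([generatedP], [preimage_generated]).  The
    differential kills the vertical vectors exactly when [mu = dL/dxi], and then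
    it descends to the covector [(v, k) |-> dL/dg v - k xi] at [(g, mu)].
    Reflexivity lets one read its second component as the vector [- xi]
    ([covector_parts]), so its trivialization is
    [(g, mu, T_e^* R_g dL/dg + ad^*_xi mu, - xi)], which is the image under
    [Omega_flat] of [(g, dL/dxi, xi, T_e^* R_g dL/dg)].

    Morse condition ([morse_family_LH]).  Moving [mu] in the direction [k],
    with everything else fixed, changes the differential affinely, by [- k] on
    the [w]-component ([tangent_im_d]).  Any covector [beta] is thus brought into
    the annihilator of the vertical vectors by subtracting such a variation,
    namely the one for [k = - beta (0, (_, 0))], and in a chart the annihilator
    is a product of an open set with a fixed closed linear subspace, so that
    what remains is tangent to it ([tangent_annihilator]).

    One-forms.  The parametrization of tangent vectors by
    [(xi2, nu2, xi3, nu3)] is a bijection because [T_e R_g] is invertible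
    ([TR_bij], [TTparamK]).  In [d Delta] the two terms
    [mu [xi, xi2]] and [mu [xi2, xi]] cancel ([dDelta]).  That [ad^*_xi mu] is the
    functional [mu [xi, _]], rather than a default value, requires the bracket
    to be linear and continuous in its second argument: in the chart at the
    identity a right invariant field is a partial derivative of the
    multiplication, and the bracket comes from a second derivative of it
    ([bracket_formula]). *)

Set Implicit Arguments.
Unset Strict Implicit.
Unset Printing Implicit Defensive.

Local Notation hom := Defs.hom.
Local Notation Hom := Defs.Hom.
Local Notation coord := Defs.coord.

(** * Continuous linear maps *)

Section HomTheory.
Context {R : realType}.
Implicit Types E F H : normedModType R.

Lemma homP E F (f g : hom E F) : f =1 g -> f = g.
Proof. by move=> fg; apply/val_inj/funext. Qed.

Lemma bounded_contlin E F (f : E -> F) (k : R) :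
  linear f -> (forall x, `|f x| <= k * `|x|) -> f \in contlin.
Proof.
move=> lf bf; apply/asboolP; split=> //.
pose fL : {linear E -> F} := HB.pack f (GRing.isLinear.Build _ _ _ _ f lf).
suff : continuous fL by [].
apply/linear_bounded_continuous/linear_boundedP.
exists k; split; first exact: num_real.
by move=> l kl x; rewrite (le_trans (bf x))// ler_wpM2r// ltW.
Qed.

Lemma to_hom_contlin E F (f : E -> F) :
  linear f -> continuous f -> to_hom f = f :> (E -> F).
Proof. by move=> lf cf; rewrite /to_hom insubdK//; apply/asboolP. Qed.

Definition hom_of_bounded E F (f : E -> F) (k : R) (lf : linear f)
  (bf : forall x, `|f x| <= k * `|x|) : hom E F := Hom (bounded_contlin lf bf).

Lemma hom_addE E F (f g : hom E F) x : (f + g) x = f x + g x.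
Proof. by []. Qed.
Lemma hom_oppE E F (f : hom E F) x : (- f) x = - f x.
Proof. by []. Qed.
Lemma hom_subE E F (f g : hom E F) x : (f - g) x = f x - g x.
Proof. by []. Qed.

Lemma hom_normP E F (f : hom E F) x : `|f x| <= `|f| * `|x|.
Proof. exact: opnormP. Qed.

Lemma hom_norm_le E F (f : hom E F) k :
  0 <= k -> (forall x, `|f x| <= k * `|x|) -> `|f| <= k.
Proof. exact: opnorm_le. Qed.

Lemma hom_compE E F H (g : hom F H) (f : hom E F) x : hom_comp g f x = g (f x).
Proof. by []. Qed.

Lemma fst_lin E F : linear (@fst E F). Proof. by []. Qed.
Lemma fst_bd E F (x : E * F) : `|x.1| <= 1 * `|x|.
Proof. by rewrite mul1r prod_normE /= le_max lexx. Qed.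
Definition hom_fst E F : hom (E * F)%type E :=
  hom_of_bounded (@fst_lin E F) (@fst_bd E F).

Lemma snd_lin E F : linear (@snd E F). Proof. by []. Qed.
Lemma snd_bd E F (x : E * F) : `|x.2| <= 1 * `|x|.
Proof. by rewrite mul1r prod_normE /= le_max lexx orbT. Qed.
Definition hom_snd E F : hom (E * F)%type F :=
  hom_of_bounded (@snd_lin E F) (@snd_bd E F).

Lemma id_bd E (x : E) : `|x| <= 1 * `|x|. Proof. by rewrite mul1r. Qed.
Definition hom_id E : hom E E := hom_of_bounded (fun _ _ _ => erefl) (@id_bd E).

Section Pair.
Context E F H (f : hom E F) (g : hom E H).
Let p x := (f x, g x).
Lemma pair_lin : linear p. Proof. by move=> k x y; rewrite /p !linearP. Qed.
Lemma pair_bd x : `|p x| <= Num.max `|f| `|g| * `|x|.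
Proof.
rewrite prod_normE /= ge_max; apply/andP; split.
  by rewrite (le_trans (hom_normP _ _))// ler_wpM2r// le_max lexx.
by rewrite (le_trans (hom_normP _ _))// ler_wpM2r// le_max lexx orbT.
Qed.
Definition hom_pair : hom E (F * H)%type := hom_of_bounded pair_lin pair_bd.
End Pair.

Section Post.
Context E F H (B : hom F H).
Let p (f : hom E F) := hom_comp B f.
Lemma post_lin : linear p.
Proof. by move=> k x y; apply: homP => u; rewrite /p /= linearP. Qed.
Lemma post_bd f : `|p f| <= `|B| * `|f|.
Proof.
apply: hom_norm_le; first by rewrite mulr_ge0.
move=> x; rewrite hom_compE (le_trans (hom_normP _ _))// -mulrA ler_wpM2l//.
exact: hom_normP.
Qed.
Definition hom_post : hom (hom E F) (hom E H) := hom_of_bounded post_lin post_bd.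
End Post.

Section Pre.
Context E F H (A : hom E F).
Let p (f : hom F H) := hom_comp f A.
Lemma pre_lin : linear p. Proof. by move=> k x y; apply: homP => u. Qed.
Lemma pre_bd f : `|p f| <= `|A| * `|f|.
Proof.
apply: hom_norm_le; first by rewrite mulr_ge0.
move=> x; rewrite hom_compE (le_trans (hom_normP _ _))//.
by rewrite [`|A| * _]mulrC -mulrA ler_wpM2l// hom_normP.
Qed.
Definition hom_pre : hom (hom F H) (hom E H) := hom_of_bounded pre_lin pre_bd.
End Pre.

Section Eval.
Context E F.
Section At.
Variable x : E.
Let p (f : hom E F) := f x.
Lemma eval_lin : linear p. Proof. by []. Qed.
Lemma eval_bd f : `|p f| <= `|x| * `|f|.
Proof. by rewrite mulrC hom_normP. Qed.
Definition hom_eval : hom (hom E F) F := hom_of_bounded eval_lin eval_bd.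
End At.
Lemma eval_hom_lin : linear hom_eval.
Proof. by move=> k x y; apply: homP => f /=; rewrite linearP. Qed.
Lemma eval_hom_bd x : `|hom_eval x| <= 1 * `|x|.
Proof. by apply: hom_norm_le => [|f]; rewrite mul1r// eval_bd. Qed.
Definition hom_eval_hom : hom E (hom (hom E F) F) :=
  hom_of_bounded eval_hom_lin eval_hom_bd.
End Eval.

Section Scale.
Context E (b : E).
Let p (t : R^o) : E := t *: b.
Lemma scl_lin : linear p.
Proof. by move=> k x y; rewrite /p scalerDl scalerA. Qed.
Lemma scl_bd t : `|p t| <= `|b| * `|t|.
Proof. by rewrite normrZ mulrC. Qed.
Definition hom_scl : hom R^o E := hom_of_bounded scl_lin scl_bd.
End Scale.

End HomTheory.

(** * Derivatives *)

Section Deriv.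
Context {R : realType}.
Implicit Types E F H : normedModType R.

Definition has_deriv E F (f : E -> F) x (A : hom E F) : Prop :=
  is_diff x f A.

Lemma differentiable_to_hom E F (f : E -> F) x :
  differentiable f x -> fderiv f x = 'd f x :> (E -> F).
Proof.
move=> df; rewrite to_hom_contlin//; first exact: linearP.
exact: diff_continuous.
Qed.

Lemma has_deriv_fderiv E F (f : E -> F) x :
  differentiable f x -> has_deriv f x (fderiv f x).
Proof. by move=> df; split=> //; rewrite differentiable_to_hom. Qed.

Lemma fderivE E F (f : E -> F) x A : has_deriv f x A -> fderiv f x = A.
Proof.
by case=> df dE; apply: homP => v; rewrite differentiable_to_hom// dE.
Qed.

Lemma has_derivI E F (f : E -> F) x (A : hom E F) :
  (forall e : R, 0 < e ->
     \forall h \near (0 : E), `|f (h + x) - (f x + A h)| <= e * `|h|) ->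
  has_deriv f x A.
Proof.
move=> fA.
have key : f \o shift x = cst (f x) + A +o_ 0 id by apply/eqaddoP.
have dE : 'd f x = A :> (E -> F).
  by apply: (diff_unique _ key); exact: hom_continuous.
split=> //; apply/diff_locallyP; rewrite dE; split=> //; exact: hom_continuous.
Qed.

Lemma has_deriv_near E F (f g : E -> F) x A :
  (\forall u \near x, f u = g u) -> has_deriv f x A -> has_deriv g x A.
Proof.
move=> fg [df dE]; apply: has_derivI => e e0.
have fgx : f x = g x by exact: nbhs_singleton fg.
have := diff_locally df; rewrite dE => /eqaddoP /(_ e e0).
have : \forall u \near 0, f (u + x) = g (u + x).
  by move: fg; rewrite (near_shift 0) subr0.
by apply: filter_app2; near=> h; rewrite -fgx => <-.
Unshelve. all: by end_near. Qed.

Lemma has_deriv_comp E F H (f : E -> F) (g : F -> H) x A B :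
  has_deriv f x A -> has_deriv g (f x) B -> has_deriv (g \o f) x (hom_comp B A).
Proof. by move=> hf hg; exact: is_diff_comp. Qed.

Lemma has_deriv_hom E F (A : hom E F) x : has_deriv A x A.
Proof.
split; first by apply: linear_differentiable; exact: hom_continuous.
by rewrite diff_lin//; exact: hom_continuous.
Qed.

Lemma has_deriv_cst E F (a : F) (x : E) : has_deriv (fun=> a) x 0.
Proof. exact: is_diff_cst. Qed.

Lemma has_derivD E F (f g : E -> F) x A B :
  has_deriv f x A -> has_deriv g x B ->
  has_deriv (fun u => f u + g u) x (A + B).
Proof. by move=> hf hg; exact: is_diffD. Qed.

Lemma has_derivN E F (f : E -> F) x A :
  has_deriv f x A -> has_deriv (fun u => - f u) x (- A).
Proof. by move=> hf; exact: is_diffN. Qed.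

Lemma has_deriv_pair E F H (f : E -> F) (g : E -> H) x A B :
  has_deriv f x A -> has_deriv g x B ->
  has_deriv (fun u => (f u, g u)) x (hom_pair A B).
Proof. by move=> hf hg; exact: is_diff_pair. Qed.

Definition pairing E F (p : hom E F * E) : F := p.1 p.2.

(** Assembled from composition and evaluation operators, so that it is
    continuous and linear in the base point too; this makes [pairing] smooth. *)
Definition dpairing E F :
    hom (hom E F * E)%type (hom (hom E F * E)%type F) :=
  hom_comp (hom_pre F (hom_snd (hom E F) E)) (hom_fst _ _)
  + hom_comp (hom_pre F (hom_fst _ _)) (hom_comp (hom_eval_hom E F) (hom_snd _ _)).

Lemma dpairingE E F (p q : hom E F * E) : dpairing E F p q = p.1 q.2 + q.1 p.2.
Proof. by []. Qed.

(** The remainder is [q.1 q.2], which is bounded by [`|q| ^+ 2]. *)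
Lemma has_deriv_pairing E F (p : hom E F * E) :
  has_deriv (@pairing E F) p (dpairing E F p).
Proof.
apply: has_derivI => e e0; near=> q.
have E1 : (q.1 + p.1) (q.2 + p.2) - (p.1 p.2 + dpairing E F p q) = q.1 q.2.
  rewrite dpairingE hom_addE [q.1 _]linearD [p.1 (_ + _)]linearD.
  rewrite [p.1 q.2 + p.1 p.2]addrC -[_ + _ + (_ + _)]addrA.
  by rewrite [q.1 p.2 + _]addrC -[p.1 p.2 + _ + _]addrA addrK.
rewrite /pairing /= E1.
have q2 : `|q.2| <= `|q| by rewrite prod_normE le_max lexx orbT.
have q1 : `|q.1| <= `|q| by rewrite prod_normE le_max lexx.
have qe : `|q| <= e.
  near: q; apply: filterS (nbhsx_ballx (0 : (hom E F * E)%type) e e0) => y.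
  by rewrite -ball_normE /= sub0r normrN => /ltW.
rewrite (le_trans (hom_normP _ _))// ler_pM//.
exact: le_trans qe.
Unshelve. all: by end_near. Qed.

End Deriv.

(** * Maps of class C^k *)

Section Smooth.
Context {R : realType}.
Implicit Types E F H : normedModType R.

Lemma Ck_eq n E F (U : set E) (f g : E -> F) : open U ->
  (forall x, U x -> f x = g x) -> Ck n U f -> Ck n U g.
Proof.
move=> oU; elim: n F f g => [|n IH] F f g fg.
  move=> cf x Ux.
  have nU : \forall y \near x, f y = g y.
    by near=> y; apply: fg; near: y; exact: open_nbhs_nbhs.
  have := cf x Ux; rewrite /prop_for /continuous_at (fg x Ux).
  by apply: cvg_trans; apply: near_eq_cvg.
case=> df Cf.
have hd x : U x -> has_deriv g x (fderiv f x).
  move=> Ux; apply: (has_deriv_near _ (has_deriv_fderiv (df x Ux))).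
  by near=> y; apply: fg; near: y; exact: open_nbhs_nbhs.
split; first by move=> x /hd[].
have fg' x : U x -> fderiv f x = fderiv g x.
  by move=> Ux; rewrite (fderivE (hd x Ux)).
exact: IH fg' Cf.
Unshelve. all: by end_near. Qed.

Lemma Ck_sub n E F (U V : set E) (f : E -> F) : U `<=` V -> Ck n V f -> Ck n U f.
Proof.
move=> UV; elim: n F f => [|n IH] F f; first by move=> cf x /UV; exact: cf.
by case=> df Cf; split=> [x /UV/df//|]; exact: IH.
Qed.

(** Replaces [fderiv f], whose values off [U] are arbitrary, by a derivative
    in closed form to which the induction on the order applies. *)
Lemma Ck_intro n E F (U : set E) (f : E -> F) (f' : E -> hom E F) : open U ->
  (forall x, U x -> has_deriv f x (f' x)) -> Ck n U f' -> Ck n.+1 U f.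
Proof.
move=> oU hf Cf; split=> [x /hf[]//|].
by apply: Ck_eq Cf => // x /hf/fderivE.
Qed.

Lemma Ck_has_deriv n E F (U : set E) (f : E -> F) x : Ck n.+1 U f -> U x ->
  has_deriv f x (fderiv f x).
Proof. by case=> df _ /df; exact: has_deriv_fderiv. Qed.

Lemma Ck_hom_left n E F H (U : set E) (f : E -> F) (B : hom F H) : open U ->
  Ck n U f -> Ck n U (B \o f).
Proof.
move=> oU; elim: n F H f B => [|n IH] F H f B.
  by move=> cf x Ux; apply: continuous_comp (cf x Ux) _; exact: hom_continuous.
move=> Cf; apply: (@Ck_intro _ _ _ _ _ (hom_post E B \o fderiv f)) => //.
  move=> x Ux; apply: has_deriv_comp; first exact: Ck_has_deriv Cf Ux.
  exact: has_deriv_hom.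
by apply: IH; case: Cf.
Qed.

Lemma open_hom_preimage E F (A : hom E F) (U : set F) : open U -> open (A @^-1` U).
Proof. by move: U; apply/continuousP; exact: hom_continuous. Qed.

Lemma Ck_hom_right n E F H (U : set F) (f : F -> H) (A : hom E F) : open U ->
  Ck n U f -> Ck n (A @^-1` U) (f \o A).
Proof.
move=> oU; elim: n H f => [|n IH] H f.
  move=> cf x Ux; apply: continuous_comp; first exact: hom_continuous.
  exact: cf.
move=> Cf.
have oV := open_hom_preimage A oU.
apply: (@Ck_intro _ _ _ _ _ (hom_pre H A \o (fderiv f \o A))) => //.
  move=> x Ux; apply: has_deriv_comp; first exact: has_deriv_hom.
  exact: Ck_has_deriv Cf Ux.
by apply: Ck_hom_left => //; apply: IH; case: Cf.
Qed.

Lemma CkD n E F (U : set E) (f g : E -> F) : open U ->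
  Ck n U f -> Ck n U g -> Ck n U (fun x => f x + g x).
Proof.
move=> oU; elim: n F f g => [|n IH] F f g.
  by move=> cf cg x Ux; apply: cvgD; [exact: cf|exact: cg].
move=> Cf Cg; apply: (@Ck_intro _ _ _ _ _ (fun x => fderiv f x + fderiv g x)) => //.
  by move=> x Ux; apply: has_derivD; apply: (Ck_has_deriv _ Ux); eassumption.
by apply: IH; [case: Cf|case: Cg].
Qed.

Lemma Ck_cst n E F (U : set E) (a : F) : open U -> Ck n U (fun=> a).
Proof.
move=> oU; elim: n F a => [|n IH] F a; first by move=> x _; exact: cvg_cst.
by apply: (Ck_intro (f' := fun=> 0)) => // x _; exact: has_deriv_cst.
Qed.

Lemma Ck_hom n E F (U : set E) (A : hom E F) : open U -> Ck n U A.
Proof.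
move=> oU; case: n => [|n]; first by move=> x _; exact: hom_continuous.
apply: (Ck_intro (f' := fun=> A)) => // [x _|]; first exact: has_deriv_hom.
exact: Ck_cst.
Qed.

Lemma Ck_pairing n E F (U : set (hom E F * E)%type) : open U ->
  Ck n U (@pairing R E F).
Proof.
move=> oU; case: n => [x _|n].
  exact/differentiable_continuous/(ex_diff (is_diff_def := has_deriv_pairing x)).
apply: (Ck_intro (f' := dpairing E F)) => // [x _|].
  exact: has_deriv_pairing.
exact: Ck_hom.
Qed.

Lemma Ck_affine n E (U : set R^o) (a b : E) : open U ->
  Ck n U (fun t : R^o => a + t *: b).
Proof. by move=> oU; apply: CkD => //; [exact: Ck_cst|exact: (Ck_hom n (hom_scl b))]. Qed.

Lemma has_deriv_affine E (a b : E) (t : R^o) :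
  has_deriv (fun t : R^o => a + t *: b) t (hom_scl b).
Proof.
rewrite -[hom_scl b]add0r; apply: has_derivD; first exact: has_deriv_cst.
exact: (has_deriv_hom (hom_scl b)).
Qed.

Lemma derive1_affine E (f : R^o -> E) (a b : E) (e : R) : 0 < e ->
  (forall t : R^o, `|t| < e -> f t = a + t *: b) ->
  Cinfty [set t : R^o | `|t| < e] f /\ b = derive1 (f : R^o -> E) 0.
Proof.
move=> e0 fE.
have oe : open [set t : R^o | `|t| < e].
  rewrite (_ : mkset _ = ball (0 : R^o) e); first exact: ball_open.
  by apply/seteqP; split=> t; rewrite -ball_normE /= sub0r normrN.
split.
  move=> n; apply: (Ck_eq oe _ (Ck_affine n a b oe)) => t te.
  by rewrite fE.
have [df dE] : has_deriv f 0 (hom_scl b).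
  apply: (has_deriv_near _ (has_deriv_affine a b 0)).
  have n0 : nbhs (0 : R^o) [set t : R^o | `|t| < e].
    by apply: open_nbhs_nbhs; split=> //=; rewrite normr0.
  by apply: filterS n0 => t te; rewrite fE.
rewrite derive1E'//.
have /= -> := congr1 (fun g => g (1 : R^o)) dE.
by rewrite scale1r.
Qed.

End Smooth.

(** * Derivatives of maps between manifolds *)

Section Charts.
Context {R : realType}.
Implicit Types E F H : normedModType R.

(** Outside [cdom] and its image the values of [coord] and [cinv] are
    arbitrary; this says that near [x] they are inverse to each other. *)
Definition regular_at M E (phi : chart M E) (x : M) : Prop :=
  cinv phi (coord phi x) = x /\
  \forall u \near coord phi x, coord phi (cinv phi u) = u.

(** [A] is the derivative of [f] at [x] read in arbitrary charts [phi] and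
    [psi], which need not be the ones that an atlas attaches to [x] and [f x].
    The second clause says that, near [x], the values of [f] are recovered from
    their coordinates; it is what the chain rule needs, and it is preserved by
    composition, so that no atlas is involved. *)
Definition chart_deriv M N E F (phi : chart M E) (psi : chart N F)
    (f : M -> N) (x : M) (A : hom E F) : Prop :=
  [/\ cinv phi (coord phi x) = x,
      \forall u \near coord phi x,
        cinv psi (coord psi (f (cinv phi u))) = f (cinv phi u) &
      has_deriv (coord psi \o f \o cinv phi) (coord phi x) A].

Lemma chart_deriv_uniq M N E F (phi : chart M E) (psi : chart N F) f x A B :
  chart_deriv phi psi f x A -> chart_deriv phi psi f x B -> A = B.
Proof. by move=> [_ _ /fderivE <-] [_ _ /fderivE <-]. Qed.

(** The equation [f x = y] is a separate premise because in a group such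
    equations, e.g. [1 * g = g], are seldom definitional. *)
Lemma chart_deriv_comp M N P E F H (phi : chart M E) (psi : chart N F)
    (chi : chart P H) f g x y A B :
  chart_deriv phi psi f x A -> chart_deriv psi chi g y B -> f x = y ->
  chart_deriv phi chi (fun z => g (f z)) x (hom_comp B A).
Proof.
move=> [phix fpsi df] + fxy; rewrite -{}fxy => -[psifx gchi dg].
have E0 : (coord psi \o f \o cinv phi) (coord phi x) = coord psi (f x).
  by rewrite /= phix.
have cf : (coord psi \o f \o cinv phi) @ coord phi x --> coord psi (f x).
  by rewrite -E0; apply: differentiable_continuous; case: df.
split=> //.
- have := cf _ gchi; rewrite /= nbhs_filterE => g'.
  by apply: filterS2 fpsi g' => u /= ->.
- apply: has_deriv_near; last by apply: has_deriv_comp df _; rewrite E0; exact: dg.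
  by apply: filterS fpsi => u /= ->.
Qed.

Lemma chart_deriv_id M E (phi : chart M E) x : regular_at phi x ->
  chart_deriv phi phi (fun y => y) x (hom_id E).
Proof.
move=> [phix nphi]; split=> //; first by apply: filterS nphi => u ->.
apply: has_deriv_near; last exact: (has_deriv_hom (hom_id E)).
by apply: filterS nphi => u /= ->.
Qed.

Lemma chart_deriv_cst M N E F (phi : chart M E) (psi : chart N F) x y :
  cinv phi (coord phi x) = x -> cinv psi (coord psi y) = y ->
  chart_deriv phi psi (fun=> y) x 0.
Proof.
move=> phix psiy; split=> //; first exact: nearW.
exact: has_deriv_cst.
Qed.

Definition prod_chart M N E F (phi : chart M E) (psi : chart N F) :
    chart (M * N) (E * F) :=
  Chart (cdom phi `*` cdom psi) (fun q => (coord phi q.1, coord psi q.2))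
        (fun u => (cinv phi u.1, cinv psi u.2)).

Lemma near_prod E F (x : E) (y : F) (P : set E) (Q : set F) :
  nbhs x P -> nbhs y Q -> \forall z \near (x, y), P z.1 /\ Q z.2.
Proof. by move=> nP nQ; exists (P, Q). Qed.

Lemma regular_prod M N E F (phi : chart M E) (psi : chart N F) x y :
  regular_at phi x -> regular_at psi y -> regular_at (prod_chart phi psi) (x, y).
Proof.
move=> [px np] [py nq]; split; first by rewrite /= px py.
by apply: filterS (near_prod np nq) => -[u v] /= [-> ->].
Qed.

Lemma chart_deriv_fst M N E F (phi : chart M E) (psi : chart N F) x y :
  regular_at phi x -> regular_at psi y ->
  chart_deriv (prod_chart phi psi) phi (@fst M N) (x, y) (hom_fst E F).
Proof.
move=> [px np] [py nq]; split; first by rewrite /= px py.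
  by apply: filterS (near_prod np nq) => -[u v] /= [-> _].
apply: has_deriv_near; last exact: (has_deriv_hom (hom_fst E F)).
by apply: filterS (near_prod np nq) => -[u v] /= [-> _].
Qed.

Lemma chart_deriv_snd M N E F (phi : chart M E) (psi : chart N F) x y :
  regular_at phi x -> regular_at psi y ->
  chart_deriv (prod_chart phi psi) psi (@snd M N) (x, y) (hom_snd E F).
Proof.
move=> [px np] [py nq]; split; first by rewrite /= px py.
  by apply: filterS (near_prod np nq) => -[u v] /= [_ ->].
apply: has_deriv_near; last exact: (has_deriv_hom (hom_snd E F)).
by apply: filterS (near_prod np nq) => -[u v] /= [_ ->].
Qed.

Lemma chart_deriv_pair M N P E F H (phi : chart M E) (psi : chart N F)
    (chi : chart P H) f g x A B :
  chart_deriv phi psi f x A -> chart_deriv phi chi g x B ->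
  chart_deriv phi (prod_chart psi chi) (fun y => (f y, g y)) x (hom_pair A B).
Proof.
move=> [px nf df] [_ ng dg]; split=> //.
  by apply: filterS2 nf ng => u /= -> ->.
exact: has_deriv_pair df dg.
Qed.

Lemma regular_model E (x y : E) : regular_at (@model_charts R E x) y.
Proof. by split=> //; exact: nearW. Qed.

(** The part of [manifold] that is used to differentiate a map already known to
    be smooth; it passes to products without a study of the changes of charts. *)
Definition regular_atlas M E (c : M -> chart M E) : Prop :=
  (forall x, cdom (c x) x) /\ (forall x y, cdom (c x) y -> regular_at (c x) y).

Lemma regular_atlas_manifold M E (c : M -> chart M E) : manifold c -> regular_atlas c.
Proof.
move=> [cx cK oc _]; split=> // x y cy; split; first exact: cK.
have oU := oc x x; rewrite setIid in oU.
apply: filterS (open_nbhs_nbhs (conj oU _)); last by exists y.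
by move=> _ [z cz <-]; rewrite cK.
Qed.

Lemma regular_atlas_model E : regular_atlas (@model_charts R E).
Proof. by split=> // x y _; exact: regular_model. Qed.

Lemma regular_atlas_prod M N E F (c : M -> chart M E) (d : N -> chart N F) :
  regular_atlas c -> regular_atlas d -> regular_atlas (prod_charts c d).
Proof.
move=> [c1 c2] [d1 d2]; split=> [x|x [y z] [/= cy dz]]; first by split.
exact: (regular_prod (c2 _ _ cy) (d2 _ _ dz)).
Qed.

Lemma chart_deriv_transition M E (c : M -> chart M E) x y z : manifold c ->
  cdom (c x) z -> cdom (c y) z ->
  chart_deriv (c x) (c y) (fun w => w) z
    (fderiv (coord (c y) \o cinv (c x)) (coord (c x) z)).
Proof.
move=> [_ cK oc Cc] cxz cyz.
have Uz : (coord (c x) @` (cdom (c x) `&` cdom (c y))) (coord (c x) z).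
  by exists z.
split; first exact: cK.
  apply: filterS (open_nbhs_nbhs (conj (oc x y) Uz)) => _ [w [cxw cyw] <-].
  by rewrite (cK _ _ cxw) (cK _ _ cyw).
exact: (Ck_has_deriv (Cc x y 1) Uz).
Qed.

Lemma smooth_chart_deriv M N E F (c : M -> chart M E) (d : N -> chart N F) f x :
  regular_atlas c -> regular_atlas d -> smooth_map c d f ->
  chart_deriv (c x) (d (f x)) f x (tangent_map c d f x).
Proof.
move=> [c1 c2] [d1 d2] /(_ x)[U [oU Ux _ Ud Cf]]; split.
- by case: (c2 _ _ (c1 x)).
- apply: filterS (open_nbhs_nbhs (conj oU Ux)) => u /Ud du.
  by case: (d2 _ _ du).
- exact: (Ck_has_deriv (Cf 1) Ux).
Qed.

Lemma tangent_mapE M N E F (c : M -> chart M E) (d : N -> chart N F) f x A :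
  chart_deriv (c x) (d (f x)) f x A -> tangent_map c d f x = A.
Proof. by case=> _ _ /fderivE. Qed.

(** Smoothness and velocity are immediate for a curve that is affine in the
    chart, and such curves suffice for all the tangent vectors needed here. *)
Lemma tangent_to_affine (M : Type) (F : normedModType R) (d : M -> chart M F)
    (S : set M) z (gamma : R^o -> M) (b : F) (e : R) : 0 < e -> gamma 0 = z ->
  (forall t, `|t| < e -> [/\ S (gamma t), cdom (d z) (gamma t) &
     coord (d z) (gamma t) = coord (d z) z + t *: b]) ->
  tangent_to d S z b.
Proof.
move=> e0 g0 H; exists gamma, e => //.
have affine t : `|t| < e -> (coord (d z) \o gamma) t = coord (d z) z + t *: b.
  by move=> /H[].
have [Cg dg] := derive1_affine e0 affine.
by split=> // t /H[].
Qed.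

End Charts.

(** * Lie groups: right translations, bracket, and the one-forms *)

Section LieGroup.
Context {R : realType} {E : normedModType R} {G : groupType} (c : G -> chart G E).
Hypothesis lg : lie_group c.

Let cM : manifold c. Proof. by case: lg. Qed.
Let cR : regular_atlas c. Proof. exact: regular_atlas_manifold cM. Qed.
Let cdx x : cdom (c x) x. Proof. by case: cR. Qed.
Let creg x y : cdom (c x) y -> regular_at (c x) y.
Proof. by case: cR => _; apply. Qed.

(** Right translation is the multiplication restricted to a slice
    [k |-> (k, g)]. *)
Lemma chart_deriv_right_mul g h :
  chart_deriv (c h) (c (h * g)%g) (fun k => (k * g)%g) h
    (tangent_map c c (fun k => (k * g)%g) h).
Proof.
have [_ sm _] := lg.
have D := smooth_chart_deriv (h, g) (regular_atlas_prod cR cR) cR sm.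
have hg : chart_deriv (c h) (prod_chart (c h) (c g)) (fun k => (k, g)) h
    (hom_pair (hom_id E) 0).
  apply: chart_deriv_pair; first exact: chart_deriv_id (creg (cdx h)).
  exact: chart_deriv_cst (creg (cdx h)).1 (creg (cdx g)).1.
have D' := chart_deriv_comp hg D erefl.
by rewrite (tangent_mapE D').
Qed.

Lemma chart_deriv_TR g :
  chart_deriv (c 1%g) (c g) (fun k => (k * g)%g) 1%g (TR c g).
Proof. by have := chart_deriv_right_mul g 1%g; rewrite mul1g. Qed.

(** The inverse is the derivative at [g] of the translation by [g^-1]. *)
Lemma TR_bij g : exists B : hom E E, cancel (TR c g) B /\ cancel B (TR c g).
Proof.
have D1 := chart_deriv_TR g.
have := chart_deriv_right_mul g^-1%g g; rewrite mulgV.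
set B := tangent_map _ _ _ _ => D2; exists B; split=> v.
  have := chart_deriv_comp D1 D2 (mul1g g).
  rewrite (_ : (fun y => _) = fun y => y); last by apply/funext => y; rewrite mulgK.
  move=> D; have := chart_deriv_uniq D (chart_deriv_id (creg (cdx _))).
  by move=> /(congr1 (fun f : hom E E => f v)).
have := chart_deriv_comp D2 D1 (mulgV g).
rewrite (_ : (fun y => _) = fun y => y); last by apply/funext => y; rewrite mulgVK.
move=> D; have := chart_deriv_uniq D (chart_deriv_id (creg (cdx _))).
by move=> /(congr1 (fun f : hom E E => f v)).
Qed.

(** Let [m] be the multiplication read in the chart at the identity, whose
    coordinate there is [u0].  By the chain rule the right invariant field of
    [eta] has the local representative [u |-> Phi u eta], where [Phi u] is the
    derivative of [m] at [(u0, u)] in its first argument.  As [m] is twice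
    differentiable, [Phi] has a derivative [Psi] at [u0], and the bracket is the
    antisymmetrization of [Psi]. *)
Lemma bracket_formula : exists (Psi : hom E (hom E E)) (Phi : hom E E),
  forall xi eta, bracket c xi eta = Psi (Phi xi) eta - Psi (Phi eta) xi.
Proof.
have [_ /(_ (1%g, 1%g))] := lg.
rewrite /= mulg1; set phi := c 1%g; set u0 := coord phi 1%g.
move=> [U [oU /= Uu0 _ Ud Cm]] _.
set m := (X in Cinfty U X) in Cm.
have phi1 : cinv phi u0 = 1%g by case: (creg (cdx 1%g)).
pose inl : hom E (E * E)%type := hom_pair (hom_id E) 0.
pose inr : hom E (E * E)%type := hom_pair 0 (hom_id E).
have ins_u (u v : E) : has_deriv (fun w : E => (w, v)) u inl.
  apply: has_deriv_pair; first exact: (has_deriv_hom (hom_id E)).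
  exact: has_deriv_cst.
have ins_v (u v : E) : has_deriv (fun w : E => (u, w)) v inr.
  apply: has_deriv_pair; first exact: has_deriv_cst.
  exact: (has_deriv_hom (hom_id E)).
pose Phi (u : E) : hom E E := hom_pre E inl (fderiv m (u0, u)).
have [_ [dm2 _]] := Cm 2%N.
have dPhi := has_deriv_comp (has_deriv_comp (ins_v u0 u0)
  (has_deriv_fderiv (dm2 _ Uu0))) (has_deriv_hom (hom_pre E inl) _).
set Psi := hom_comp _ _ in dPhi.
have repE eta : \forall u \near u0,
    field_rep c (right_inv_field c eta) 1%g u = Phi u eta.
  have nim : nbhs u0 (coord phi @` cdom phi).
    have [_ _ /(_ 1%g 1%g) oc _] := cM; rewrite setIid in oc.
    apply: open_nbhs_nbhs; split; first exact: oc.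
    by exists 1%g; first exact: cdx.
  have nU : nbhs u0 [set u | U (u0, u)].
    have cu : (fun w : E => (u0, w)) @ u0 --> (u0, u0).
      by apply: differentiable_continuous; case: (ins_v u0 u0).
    by apply: (cu U); apply: open_nbhs_nbhs; split.
  apply: filterS2 nim nU => _ [y cy <-] /= Uy.
  have yK : cinv phi (coord phi y) = y by case: (creg cy).
  rewrite /field_rep /right_inv_field -/phi yK.
  have nU' : nbhs u0 [set u | U (u, coord phi y)].
    have cu : (fun w : E => (w, coord phi y)) @ u0 --> (u0, coord phi y).
      by apply: differentiable_continuous; case: (ins_u u0 (coord phi y)).
    by apply: (cu U); apply: open_nbhs_nbhs; split.
  (* Both sides are the derivative at the identity of the translation by [y],
     read in the chart [phi]. *)
  have D : chart_deriv phi phi (fun k => (k * y)%g) 1%g (Phi (coord phi y)).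
    split=> //.
      apply: filterS nU' => u /= /Ud /=; rewrite yK => cuy.
      by case: (creg cuy).
    have := has_deriv_comp (ins_u u0 (coord phi y)) (Ck_has_deriv (Cm 1) Uy).
    rewrite (_ : m \o _ = coord phi \o (fun k => (k * y)%g) \o cinv phi)//.
    by apply/funext => u; rewrite /m /= yK.
  have T := chart_deriv_transition cM (cdx y) cy.
  have := chart_deriv_uniq (chart_deriv_comp (chart_deriv_TR y) T (mul1g y)) D.
  by move=> /(congr1 (fun f : hom E E => f eta)).
exists Psi, (Phi u0) => xi eta.
have dE eta' : fderiv (field_rep c (right_inv_field c eta') 1%g) u0
    = hom_comp (hom_eval E eta') Psi.
  apply: fderivE; apply: (has_deriv_near (f := fun u => Phi u eta')).
    by apply: filterS (repE eta') => u ->.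
  exact: has_deriv_comp dPhi (has_deriv_hom (hom_eval E eta') _).
rewrite /bracket /jacobi_lie -/phi -/u0 !dE.
by rewrite !(nbhs_singleton (repE _)).
Qed.

Lemma bracket_anti xi eta : bracket c xi eta = - bracket c eta xi.
Proof. by have [Psi [Phi bE]] := bracket_formula; rewrite !bE opprB. Qed.

Lemma bracket_hom xi : exists A : hom E E, forall eta, bracket c xi eta = A eta.
Proof.
have [Psi [Phi bE]] := bracket_formula.
by exists (Psi (Phi xi) - hom_comp (hom_eval E xi) (hom_comp Psi Phi)) => eta.
Qed.

(** [to_hom] yields a default value on a functional that is not linear and
    continuous; [bracket_hom] excludes this. *)
Lemma ad_starE xi (mu : dual E) eta : ad_star c xi mu eta = mu (bracket c xi eta).
Proof.
have [A bE] := bracket_hom xi.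
rewrite /ad_star (_ : (fun eta => _) = hom_comp mu A :> (E -> R^o)); last first.
  by apply/funext => v; rewrite bE.
by rewrite to_hom_contlin ?bE//; [exact: hom_linear|exact: hom_continuous].
Qed.

Lemma ad_starN xi (mu : dual E) : ad_star c (- xi) mu = - ad_star c xi mu.
Proof.
apply: homP => eta; rewrite ad_starE hom_oppE ad_starE bracket_anti.
have [A bE] := bracket_hom eta.
by rewrite [in RHS]bracket_anti !bE !linearN.
Qed.

(** [TTvec] is triangular: [xi2] is recovered from the first component because
    [TR] is invertible, and then the other parameters by subtraction. *)
Lemma TTvec_inj z : injective (TTvec c z).
Proof.
case: z => -[g mu] [xi nu] [[xi2 nu2] [xi3 nu3]] [[xi2' nu2'] [xi3' nu3']].
have [B [BK _]] := TR_bij g.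
move=> ab.
have /(can_inj BK) e1 := congr1 (fun u => u.1.1) ab; subst xi2'.
have /addIr e2 := congr1 (fun u => u.1.2) ab; subst nu2'.
have /addIr e3 := congr1 (fun u => u.2.1) ab; subst xi3'.
by have /addIr/addIr -> := congr1 (fun u => u.2.2) ab.
Qed.

Lemma TTvec_surj z v : exists a, TTvec c z a = v.
Proof.
case: z v => -[g mu] [xi nu] [[v1 v2] [v3 v4]].
have [B [_ BK]] := TR_bij g.
exists ((B v1, v2 - ad_star c (B v1) mu),
  (v3 - bracket c xi (B v1), v4 + ad_star c xi (v2 - ad_star c (B v1) mu)
     - ad_star c (B v1) nu)).
by rewrite /TTvec BK !subrK addrK.
Qed.

Lemma TTparamK z a : TTparam c z (TTvec c z a) = a.
Proof.
rewrite /TTparam; case: xgetP => [b _ /TTvec_inj //|/(_ a)] /=.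
by move=> /(_ erefl).
Qed.

Lemma theta_diff g mu xi nu xi2 nu2 xi3 nu3 :
  let z := ((g, mu), (xi, nu)) in
  let X := TTvec c z ((xi2, nu2), (xi3, nu3)) in
  theta1 c z X - theta2 c z X = - mu xi3 - nu2 xi.
Proof.
move=> z X; rewrite /theta1 /theta2 /X TTparamK /z.
rewrite [nu xi2 - nu2 xi]addrC opprD addrACA subrr addr0 opprD addrACA subrr addr0.
by rewrite addrC.
Qed.

(** At [X_(xi2,nu2,xi3,nu3)] the component of [mu] is [nu2 + ad^*_xi2 mu] and that
    of [xi] is [xi3 + [xi, xi2]]; the contributions [mu [xi2, xi]] and
    [mu [xi, xi2]] to the derivative of [mu xi] cancel. *)
Lemma dDelta z v : dfun (TTG_charts c) (@Delta R G E) z v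
  = theta1 c z v - theta2 c z v.
Proof.
have [[[xi2 nu2] [xi3 nu3]] <-] := TTvec_surj z v.
case: z => -[g mu] [xi nu].
pose sub : hom ((E * dual E) * (E * dual E))%type (dual E * E)%type :=
  hom_pair (hom_comp (hom_snd _ _) (hom_fst _ _)) (hom_comp (hom_fst _ _) (hom_snd _ _)).
have D := has_derivN (has_deriv_comp (has_deriv_hom sub
  ((coord (c g) g, mu), (xi, nu))) (has_deriv_pairing (mu, xi))).
rewrite /dfun /tangent_map /=.
rewrite (_ : (_ \o _ \o _) = (fun u => - ((pairing (F:=R^o)) \o sub) u)); last first.
  by apply/funext => -[[? ?] [? ?]].
rewrite (fderivE D) theta_diff hom_oppE hom_compE dpairingE /=.
rewrite -[LHS]/(- (mu (xi3 + bracket c xi xi2) + (nu2 xi + ad_star c xi2 mu xi))).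
rewrite ad_starE [bracket c xi2 xi]bracket_anti linearN [mu (xi3 + _)]linearD.
have cancel_middle (a b d : R) : - (a + b + (d - b)) = - a - d.
  by rewrite [d - b]addrC -addrA addNKr opprD.
exact: cancel_middle.
Qed.

End LieGroup.

(** * The generating function and its differential *)

Section Lagrangian.
Context {R : realType} {E : normedModType R} {G : groupType} (c : G -> chart G E).
Hypothesis cM : manifold c.
Variable L : G * E -> R^o.
Hypothesis smL : smooth_fun (prod_charts c (@model_charts R E)) L.

Let cR : regular_atlas c := regular_atlas_manifold cM.
Let cdx x : cdom (c x) x. Proof. by case: cR. Qed.
Let creg x y : cdom (c x) y -> regular_at (c x) y.
Proof. by case: cR => _; apply. Qed.

Local Notation D := (dual E).
Local Notation W := (E * (E * D))%type.
Local Notation cP := (PG_charts c).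
Local Notation ELH := (morse_LH L).

Let PR : regular_atlas cP.
Proof.
exact: regular_atlas_prod cR (regular_atlas_prod (@regular_atlas_model R E) (@regular_atlas_model R D)).
Qed.

Definition lagrangian_part : hom W (E * E)%type :=
  hom_pair (hom_fst _ _) (hom_comp (hom_fst _ _) (hom_snd _ _)).
Definition pairing_part : hom W (D * E)%type :=
  hom_pair (hom_comp (hom_snd _ _) (hom_snd _ _)) (hom_comp (hom_fst _ _) (hom_snd _ _)).
Definition proj_part : hom W (E * D)%type :=
  hom_pair (hom_fst _ _) (hom_comp (hom_snd _ _) (hom_snd _ _)).

Lemma chart_deriv_proj (p : G * (E * D)) :
  chart_deriv (cP p) (GD_charts c (PG_proj p)) (@PG_proj R G E) p proj_part.
Proof.
case: p => g [xi mu].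
have r1 := creg (cdx g).
have r2 := regular_model xi xi.
have r3 := regular_model mu mu.
have r23 := regular_prod r2 r3.
exact: chart_deriv_pair (chart_deriv_fst r1 r23)
  (chart_deriv_comp (chart_deriv_snd r1 r23) (chart_deriv_snd r2 r3) erefl).
Qed.

Definition dL g xi : dual (E * E)%type :=
  dfun (prod_charts c (@model_charts R E)) L (g, xi).

Lemma chart_deriv_L g xi : chart_deriv (prod_chart (c g) (@model_charts R E xi))
  (@model_charts R R^o (L (g, xi))) L (g, xi) (dL g xi).
Proof.
exact: smooth_chart_deriv (g, xi) (regular_atlas_prod cR (@regular_atlas_model R E))
  (@regular_atlas_model R R^o) smL.
Qed.

Lemma dL_dgE g xi : dL_dg c L g xi = hom_comp (dL g xi) (hom_pair (hom_id E) 0).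
Proof.
have i : chart_deriv (c g) (prod_chart (c g) (@model_charts R E xi))
    (fun h => (h, xi)) g (hom_pair (hom_id E) 0).
  apply: chart_deriv_pair; first exact: chart_deriv_id (creg (cdx g)).
  exact: chart_deriv_cst (creg (cdx g)).1 _.
exact: tangent_mapE (chart_deriv_comp i (chart_deriv_L g xi) erefl).
Qed.

Lemma dL_dxiE g xi : dL_dxi L g xi = hom_comp (dL g xi) (hom_pair 0 (hom_id E)).
Proof.
have i : chart_deriv (@model_charts R E xi) (prod_chart (c g) (@model_charts R E xi))
    (fun eta => (g, eta)) xi (hom_pair 0 (hom_id E)).
  apply: chart_deriv_pair; last exact: chart_deriv_id (regular_model xi xi).
  exact: chart_deriv_cst _ (creg (cdx g)).1.
exact: tangent_mapE (chart_deriv_comp i (chart_deriv_L g xi) erefl).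
Qed.

Lemma dL_split g xi v w : dL g xi (v, w) = dL_dg c L g xi v + dL_dxi L g xi w.
Proof.
rewrite dL_dgE dL_dxiE !hom_compE -linearD; congr (dL g xi _).
by apply: injective_projections; rewrite /= ?addr0 ?add0r.
Qed.

Definition dmorse (p : G * (E * D)) : dual W :=
  hom_comp (dL p.1 p.2.1) lagrangian_part
  - hom_comp (dpairing E R^o (p.2.2, p.2.1)) pairing_part.

Lemma dmorseE g xi mu v w k : dmorse (g, (xi, mu)) (v, (w, k)) =
  dL_dg c L g xi v + (dL_dxi L g xi w - mu w) - k xi.
Proof.
rewrite /dmorse hom_subE !hom_compE dpairingE dL_split /=.
by rewrite opprD !addrA.
Qed.

Lemma morse_LHE : ELH = fun p => L (p.1, p.2.1) - pairing (F := R^o) (p.2.2, p.2.1).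
Proof. by apply/funext => -[g [xi mu]]. Qed.

Lemma dfun_morse p : dfun cP ELH p = dmorse p.
Proof.
case: p => g [xi mu].
have r1 := creg (cdx g).
have r2 := regular_model xi xi.
have r3 := regular_model mu mu.
have r23 := regular_prod r2 r3.
have dxi := chart_deriv_comp (chart_deriv_snd r1 r23) (chart_deriv_fst r2 r3) erefl.
have dmu := chart_deriv_comp (chart_deriv_snd r1 r23) (chart_deriv_snd r2 r3) erefl.
have d1 := chart_deriv_comp (chart_deriv_pair (chart_deriv_fst r1 r23) dxi)
  (chart_deriv_L g xi) erefl.
have d2 := chart_deriv_pair dmu dxi.
have d3 : chart_deriv (prod_chart (@model_charts R D mu) (@model_charts R E xi))
    (@model_charts R R^o 0) (@pairing R E R^o) (mu, xi) (dpairing E R^o (mu, xi)).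
  split=> //.
    by apply: (@nearW _ (nbhs (mu, xi))).
  apply: (has_deriv_near _ (has_deriv_pairing (mu, xi))).
  by apply: (@nearW _ (nbhs (mu, xi))) => -[].
have [_ _ h3] := chart_deriv_comp d2 d3 erefl.
have [_ _ h1] := d1.
rewrite /dfun /tangent_map morse_LHE; apply: fderivE.
exact: has_derivD h1 (has_derivN h3).
Qed.

Lemma morse_smooth : smooth_fun cP ELH.
Proof.
move=> [g [xi mu]].
have [U [oU Uu Uim _ CU]] := smL (g, xi).
exists (lagrangian_part @^-1` U); split=> //.
- exact: open_hom_preimage.
- move=> -[u [x m]] /= /Uim[[h y] [/= ch _] [hu yx]].
  by exists (h, (y, m)) => //=; rewrite hu yx.
move=> n.
rewrite (_ : _ \o _ \o _ = fun u =>
  ((L \o cinv (prod_charts c (@model_charts R E) (g, xi))) \o lagrangian_part) u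
  + ((- hom_id R^o) \o (@pairing R E R^o \o pairing_part)) u); last first.
  by rewrite morse_LHE; apply/funext => -[u [x m]].
have oV := open_hom_preimage lagrangian_part oU.
apply: CkD => //; first by apply: Ck_hom_right => //; exact: CU.
apply: Ck_hom_left => //.
have := @Ck_hom_right R n _ _ _ setT _ pairing_part openT (Ck_pairing n openT).
rewrite preimage_setT => CT.
by apply: Ck_sub CT.
Qed.

(** The differential of the projection forgets the component [w] in the Lie
    algebra, so a covector [lam] is generated when it agrees with the
    differential of the function for every [w]: the coefficient
    [dL/dxi - mu] of [w] vanishes and the rest is [lam]. *)
Lemma generatedP (g : G) (mu : D) (lam : dual (E * D)%type) :
  generated cP (GD_charts c) (@PG_proj R G E) ELH ((g, mu), lam) <->
  exists xi, mu = dL_dxi L g xi /\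
    forall v k, lam (v, k) = dL_dg c L g xi v - k xi.
Proof.
split.
  move=> [[g' [xi mu']] /= [-> ->]] {g' mu'}.
  rewrite (tangent_mapE (chart_deriv_proj _)) dfun_morse// => H.
  have {}H v w k : lam (v, k) = dL_dg c L g xi v + (dL_dxi L g xi w - mu w) - k xi.
    by have := congr1 (fun f : dual W => f (v, (w, k))) H; rewrite dmorseE// => <-.
  exists xi; split=> [|v k]; last by rewrite (H v 0 k) !linear0 ?subr0 !addr0.
  apply: homP => w; have := H 0 w 0; rewrite (H 0 0 0) => /addIr/addrI.
  rewrite !linear0 ?subr0 ?addr0.
  by move/esym/eqP; rewrite subr_eq0 => /eqP.
move=> [xi [muE lamE]]; exists (g, (xi, mu)) => //=.
rewrite (tangent_mapE (chart_deriv_proj _)) dfun_morse//.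
apply: homP => -[v [w k]].
by rewrite dmorseE// -muE subrr addr0 -lamE.
Qed.

(** * The Morse condition *)

Definition vertical_in : hom E W := hom_pair 0 (hom_pair (hom_id E) 0).
Definition vertical_proj : hom W E := hom_comp (hom_fst _ _) (hom_snd _ _).

Lemma verticalP (p : G * (E * D)) (v : W) :
  vertical cP (GD_charts c) (@PG_proj R G E) p v <-> exists w, v = vertical_in w.
Proof.
rewrite /vertical /= (tangent_mapE (chart_deriv_proj _)); split.
  case: v => v [w k] H; exists w.
  have /= -> := congr1 fst H.
  by have /= -> := congr1 snd H.
by move=> [w ->].
Qed.

(** The charts of the Pontryagin bundle are the identity on the fibre, so their
    changes fix the vertical directions. *)
Lemma PG_transition p q z : cdom (cP p) z -> cdom (cP q) z ->
  chart_deriv (cP p) (cP q) (fun w => w) z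
    (fderiv (coord (cP q) \o cinv (cP p)) (coord (cP p) z)) /\
  (forall w, fderiv (coord (cP q) \o cinv (cP p)) (coord (cP p) z)
     (vertical_in w) = vertical_in w).
Proof.
case: p q z => [g [x1 m1]] [h [x2 m2]] [k [x m]] [/= ck _] [/= dk _].
have T := chart_deriv_transition cM ck dk.
have r1 := creg ck.
have r2 := regular_model x1 x.
have r3 := regular_model m1 m.
have r23 := regular_prod r2 r3.
have H : chart_deriv (cP (g, (x1, m1))) (cP (h, (x2, m2))) (fun w => (w.1, w.2))
    (k, (x, m)) _ :=
  chart_deriv_pair (chart_deriv_comp (chart_deriv_fst r1 r23) T erefl)
    (chart_deriv_snd r1 r23).
have etaE : (fun w : G * (E * D) => (w.1, w.2)) = (fun w => w).
  by apply/funext => -[].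
rewrite etaE in H.
have [_ _ /fderivE ->] := H; split=> // w.
by apply: injective_projections => //=; exact: linear0.
Qed.

Lemma trans_invK p y : cdom (cP p) y ->
  hom_comp (trans cP p y) (trans_inv cP p y) = hom_id W.
Proof.
move=> py; have yy : cdom (cP y) y by case: PR.
have [T _] := PG_transition yy py.
have [T' _] := PG_transition py yy.
have ry : regular_at (cP p) y by case: PR => _; apply.
exact: chart_deriv_uniq (chart_deriv_comp T' T erefl) (chart_deriv_id ry).
Qed.

(** Over one point of the group all the charts of the Pontryagin bundle agree. *)
Lemma trans_inv_fibre p y : p.1 = y.1 -> trans_inv cP p y = hom_id W.
Proof.
case: p y => g [x m] [h [x' m']] /= gh; subst h.
have py : cdom (cP (g, (x, m))) (g, (x', m')) by split=> //=; exact: cdx.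
have ry : regular_at (cP (g, (x, m))) (g, (x', m')) by case: PR => _; apply.
by have [_ _ /fderivE] := chart_deriv_id ry.
Qed.

(** Along [t |-> (g, (xi, mu + t k))] the differential is affine in [t], because
    [mu] enters it linearly. *)
Lemma tangent_im_d (g : G) (xi : E) (mu : D) (al : dual W) (k : D) :
  al = dfun cP ELH (g, (xi, mu)) ->
  tangent_to (cotangent_charts cP) (im_d cP ELH) ((g, (xi, mu)), al)
    ((0, (0, k)), - hom_comp k vertical_proj).
Proof.
move=> alE.
pose gamma (t : R^o) : (G * (E * D)) * dual W :=
  ((g, (xi, mu + t *: k)), dfun cP ELH (g, (xi, mu + t *: k))).
have gamma0 : gamma 0 = ((g, (xi, mu)), al).
  by rewrite /gamma scale0r addr0 alE.
refine (tangent_to_affine (@ltr01 R) gamma0 _).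
move=> t _; split.
- exact: erefl.
- by split; first exact: cdx.
rewrite alE /= !trans_inv_fibre// !dfun_morse//.
apply: injective_projections; rewrite /=.
  apply: injective_projections => /=; first by rewrite scaler0 addr0.
  by apply: injective_projections => /=; rewrite ?scaler0 ?addr0.
apply: homP => -[v [w k']].
rewrite -[LHS]/(dmorse (g, (xi, mu + t *: k)) (v, (w, k'))).
rewrite -[RHS]/(dmorse (g, (xi, mu)) (v, (w, k')) + t *: - k w) !dmorseE.
rewrite -[(mu + _) w]/(mu w + t *: k w) scalerN opprD !addrA.
exact: (addrAC (dL_dg c L g xi v + dL_dxi L g xi w - mu w : R)).
Qed.

(** In the chart at [(p, al)] the annihilator consists of the covectors that
    vanish on one fixed subspace, by [PG_transition]; a segment between such
    covectors, over a segment in the base, therefore stays in it. *)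
Lemma tangent_annihilator (p : G * (E * D)) (al : dual W) (b : W) (a : dual W) :
  (forall w, al (vertical_in w) = 0) -> (forall w, a (vertical_in w) = 0) ->
  tangent_to (cotangent_charts cP)
    (vertical_annihilator cP (GD_charts c) (@PG_proj R G E)) (p, al) (b, a).
Proof.
move=> alV aV.
pose y (t : R^o) : G * (E * D) := cinv (cP p) (coord (cP p) p + t *: b).
(* Only the coordinate in the group restricts the length of the segment: its
   chart has an open image, the other factors are vector spaces. *)
have [e e0 He] : exists2 e : R, 0 < e & forall t : R^o, `|t| < e ->
    (coord (c p.1) @` cdom (c p.1)) (coord (c p.1) p.1 + t *: b.1).
  have nim : nbhs (coord (c p.1) p.1) (coord (c p.1) @` cdom (c p.1)).
    have [_ _ /(_ p.1 p.1) oc _] := cM; rewrite setIid in oc.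
    by apply: open_nbhs_nbhs; split=> //; exists p.1.
  have cv : (fun t : R^o => coord (c p.1) p.1 + t *: b.1) @ (0 : R^o) -->
      coord (c p.1) p.1.
    have := differentiable_continuous
      (ex_diff (is_diff_def := has_deriv_affine (coord (c p.1) p.1) b.1 0)).
    by rewrite /prop_for /continuous_at scale0r addr0.
  have /nbhs_ballP[e e0 eP] := cv _ nim.
  exists e => // t te; apply: eP; by rewrite -ball_normE /= sub0r normrN.
have yP t : `|t| < e -> cdom (cP p) (y t) /\ coord (cP p) (y t) = coord (cP p) p + t *: b.
  move=> /He[h ch hE].
  have yE : y t = (h, (p.2.1 + t *: b.2.1, p.2.2 + t *: b.2.2)).
    by rewrite /y /= -hE (creg ch).1.
  by rewrite yE; split=> //=; rewrite hE.
have y0 : y 0 = p.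
  have [rp _] : regular_at (cP p) p by case: PR => cc; apply.
  by rewrite /y scale0r addr0 rp.
have pp : cdom (cP p) p by case: PR.
have al0 : hom_comp al (trans cP p p) = al.
  have rp : regular_at (cP p) p by case: PR => _; apply.
  have [T _] := PG_transition pp pp.
  have TE : trans cP p p = hom_id W := chart_deriv_uniq T (chart_deriv_id rp).
  by rewrite TE; apply: homP.
pose gamma (t : R^o) : (G * (E * D)) * dual W :=
  (y t, hom_comp (al + t *: a) (trans cP p (y t))).
have gamma0 : gamma 0 = (p, al) by rewrite /gamma y0 scale0r addr0 al0.
refine (tangent_to_affine e0 gamma0 _).
move=> t te; have [py cy] := yP t te.
split=> //.
  move=> v /verticalP[w ->] /=.
  have yy : cdom (cP (y t)) (y t) by case: PR.
  have [_ Tw] := PG_transition yy py.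
  rewrite -[LHS]/((al + t *: a) (trans cP p (y t) (vertical_in w))) Tw.
  rewrite -[LHS]/(al (vertical_in w) + t *: a (vertical_in w)) alV aV.
  by rewrite scaler0 addr0.
rewrite -[LHS]/(coord (cP p) (y t),
  hom_comp (hom_comp (al + t *: a) (trans cP p (y t))) (trans_inv cP p (y t))).
rewrite -[X in _ = X + _]/(coord (cP p) p, hom_comp al (trans_inv cP p p)).
rewrite cy (@trans_inv_fibre p p)//.
apply: injective_projections => //=.
apply: homP => v.
rewrite -[LHS]/((al + t *: a)
  (hom_comp (trans cP p (y t)) (trans_inv cP p (y t)) v)).
by rewrite (trans_invK py).
Qed.

Lemma morse_family_LH : morse_family cP (GD_charts c) (@PG_proj R G E) ELH.
Proof.
split; first exact: morse_smooth.
move=> [[g [xi mu]] al] [/= alE alV]; apply/seteqP; split=> // -[b beta] _.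
(* This choice makes [beta + k o vertical_proj] vanish on vertical vectors. *)
pose k : D := - hom_comp beta vertical_in.
exists ((0, (0, k)), - hom_comp k vertical_proj); first exact: tangent_im_d.
exists (b - (0, (0, k)), beta + hom_comp k vertical_proj).
  apply: tangent_annihilator => w; first by apply: alV; apply/verticalP; exists w.
  by rewrite hom_addE hom_compE /k hom_oppE hom_compE subrr.
by apply: injective_projections => /=; [rewrite addrC subrK|rewrite addrC addrK].
Qed.

End Lagrangian.

(** * The generated Lagrangian submanifold *)

Section Generated.
Context {R : realType} {E : normedModType R} {G : groupType} (c : G -> chart G E).
Hypothesis lg : lie_group c.
Hypothesis rE : reflexive_space E.
Variable L : G * E -> R^o.
Hypothesis smL : smooth_fun (prod_charts c (@model_charts R E)) L.

Let cM : manifold c. Proof. by case: lg. Qed.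

Local Notation D := (dual E).
Local Notation cP := (PG_charts c).
Local Notation ELH := (morse_LH L).

(** [- x] represents the second component; uniqueness of the representative in
    [reflexive_space] shows that the choice in [covector_mu] is this vector. *)
Lemma covector_parts (lam : dual (E * D)%type) (alpha : D) (x : E) :
  (forall v k, lam (v, k) = alpha v - k x) ->
  covector_g lam = alpha /\ covector_mu lam = - x.
Proof.
move=> lamE; split.
  apply: homP => v; rewrite /covector_g (_ : (fun v => _) = alpha :> (E -> R^o)).
    by rewrite to_hom_contlin//; [exact: hom_linear|exact: hom_continuous].
  by apply/funext => u; rewrite lamE /= subr0.
rewrite /covector_mu; case: xgetP => [y _ /= lamy|/(_ (- x))]; last first.
  by case=> phi; rewrite lamE !linearN /= linear0 add0r.
have [z [_ zP]] := rE (hom_eval R^o y).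
rewrite -(zP y)//; apply: zP => phi /=.
by rewrite -[LHS]/(phi y) -lamy lamE linear0 add0r linearN.
Qed.

(** The trivialized covector has last component [- xi], so [tr1] subtracts
    [ad^*_(- xi) mu = - ad^*_xi mu]: this is the term that [Omega_flat] adds. *)
Lemma preimage_generated : @Omega_flat R G E c @^-1`
        (tr1 c @` generated cP (GD_charts c) (@PG_proj R G E) ELH)
        = lagrangian_submanifold c L.
Proof.
apply/seteqP; split=> -[[g mu] [xi nu]].
  move=> [[[g' mu'] lam] /(generatedP cM smL)[xi' [muE lamE]]].
  have [ag amu] := covector_parts lamE.
  rewrite /tr1 ag amu (ad_starN lg) opprK => H.
  have eg := congr1 (fun u => u.1.1) H; rewrite /= in eg.
  have emu := congr1 (fun u => u.1.2) H; rewrite /= in emu.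
  have exi := congr1 (fun u => u.2.2) H; rewrite /= in exi.
  have enu := congr1 (fun u => u.2.1) H; rewrite /= in enu.
  move: enu; rewrite -emu -(oppr_inj exi) => /addIr <-.
  by exists g', xi'; rewrite -eg -muE (oppr_inj exi).
move=> [g' [xi' H]].
have eg := congr1 (fun u => u.1.1) H; rewrite /= in eg.
have emu := congr1 (fun u => u.1.2) H; rewrite /= in emu.
have exi := congr1 (fun u => u.2.1) H; rewrite /= in exi.
have enu := congr1 (fun u => u.2.2) H; rewrite /= in enu.
rewrite {H} enu {nu enu} exi {xi exi} emu {mu emu} eg {g eg}.
pose lam : dual (E * D)%type :=
  hom_comp (dL_dg c L g' xi') (hom_fst _ _) - hom_comp (hom_eval R^o xi') (hom_snd _ _).
have lamE v k : lam (v, k) = dL_dg c L g' xi' v - k xi' by [].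
exists ((g', dL_dxi L g' xi'), lam); first by apply/(generatedP cM smL); exists xi'.
have [ag amu] := covector_parts lamE.
by rewrite /tr1 ag amu (ad_starN lg) opprK.
Qed.

End Generated.

Theorem mainTheorem5 (R : realType) (E : completeNormedModType R)
    (G : groupType) (c : G -> chart G E) (L : G * E -> R^o) :
  lie_group c ->
  reflexive_space E ->
  smooth_fun (prod_charts c (@model_charts R E)) L ->
  [/\ morse_family (PG_charts c) (GD_charts c) (@PG_proj R G E) (morse_LH L),
      @Omega_flat R G E c @^-1`
        (tr1 c @` generated (PG_charts c) (GD_charts c) (@PG_proj R G E)
                            (morse_LH L))
        = lagrangian_submanifold c L,
      (forall z v, dfun (TTG_charts c) (@Delta R G E) z v
                   = theta1 c z v - theta2 c z v) &
      (forall g mu xi nu xi2 nu2 xi3 nu3,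
         let z := ((g, mu), (xi, nu)) in
         let X := TTvec c z ((xi2, nu2), (xi3, nu3)) in
         theta1 c z X - theta2 c z X = - mu xi3 - nu2 xi) ].
Proof.
move=> lg rE smL; have [cM _ _] := lg; split.
- exact: morse_family_LH.
- exact: preimage_generated.
- exact: dDelta.
- exact: theta_diff.
Qed.
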